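(* Let $D\subseteq\mathbb{Z}^2$ be a finite convex shape, let $a,b$ be non-negative integers, let $g=f_D-(b-a)$, and let $E$ be the set of non-zero primitive vectors $\vec v$ such that $g$ has an outer edge in direction $\vec v$. (1) Assume $b-a=0$. For $\vec v\in E$ write $\mathcal{F}_{\vec v}(g)=\{\phi_{n_1},\dots,\phi_{n_r}\}$ and $d_{\vec v}=\gcd(n_1,\dots,n_r)$. If $d_{\vec v}=1$ for all $\vec v\in E$, then every $(D,b,a)$-covering is two-periodic. If $d_{\vec v}=1$ for all $\vec v\in E$ except possibly for some vectors that are all parallel to each other, then every $(D,b,a)$-covering is periodic. (2) Assume $b-a\neq0$. For $\vec v\in E$ write $\mathcal{F}'_{\vec v}(g)=\{\phi_{n_1},\dots,\phi_{n_r}\}$ and $d_{\vec v}=\gcd(n_1,\dots,n_r)$. If, for every $\vec v\in E$, the $d_{\vec v}$-th cyclotomic polynomial and $\mathrm{fib}_{\vec v}(g)$ have no common factors, then every $(D,b,a)$-covering is two-periodic. If this condition holds for all $\vec v\in E$ except possibly for some vectors that are all parallel to each other, then every $(D,b,a)$-covering is periodic. (In particular the condition holds for $\vec v$ whenever $d_{\vec v}=1$.)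
   Context: $D$ is convex if $D=\mathrm{conv}(D)\cap\mathbb{Z}^2$, where $\mathrm{conv}$ denotes the real convex hull. Write $X^{\vec u}=x^{u_1}y^{u_2}$ and $f_D=\sum_{\vec u\in D}X^{-\vec u}$. For $n\ge1$ let $\phi_n=1+t+\dots+t^{n-1}\in\mathbb{C}[t]$. Outer edges: for non-zero $\vec v=(v_1,v_2)$ let $\vec v^\perp=(v_2,-v_1)$, $\overline H_{\vec v}=\{\vec u\in\mathbb{Z}^2:\langle\vec u,\vec v^\perp\rangle\ge0\}$ and $l_{\vec v}=\{\vec u:\langle\vec u,\vec v^\perp\rangle=0\}$. A finite set $S$ has an outer edge in direction $\vec v$ if there is $\vec t$ with $S\subseteq\overline H_{\vec v}+\vec t$ and $|S\cap(l_{\vec v}+\vec t)|\ge2$. A polynomial has an outer edge in direction $\vec v$ if its support does. A vector is primitive if its components are coprime. Normal forms and fibers: a non-zero polynomial supported on a line in primitive direction $\vec v$ is written uniquely as $X^{\vec u}(a_0+a_1X^{\vec v}+\dots+a_nX^{n\vec v})$ with $a_0,a_n\neq0$ (for a monomial $aX^{\vec u}$, $n=0$ and $a_0=a$); its normal form is $a_0+a_1t+\dots+a_nt^n\in\mathbb{C}[t]$. For $g=\sum g_{\vec u}X^{\vec u}$, the $\vec v$-fiber through $\vec u$ is $\sum_{k\in\mathbb{Z}}g_{\vec u+k\vec v}X^{\vec u+k\vec v}$. $\mathcal{F}_{\vec v}(g)$ is the set of normal forms of all non-zero $\vec v$-fibers of $g$. $\mathcal{F}'_{\vec v}(g)$ is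 the set of normal forms of the non-zero $\vec v$-fibers through points $\vec u\notin\mathbb{Z}\vec v$. $\mathrm{fib}_{\vec v}(g)$ is the normal form of the fiber $\sum_k g_{k\vec v}X^{k\vec v}$ through the origin. A $(D,b,a)$-covering is $c\in\{0,1\}^{\mathbb{Z}^2}$ such that for every $\vec u$, the number of $\vec w\in\vec u+D$ with $c_{\vec w}=1$ is $a$ if $c_{\vec u}=0$ and $b$ if $c_{\vec u}=1$. A configuration $c$ is $\vec t$-periodic if $c_{\vec u+\vec t}=c_{\vec u}$ for all $\vec u$. It is periodic if it is $\vec t$-periodic for some non-zero $\vec t$, and two-periodic if it is periodic with respect to two linearly independent vectors.
   Formalization: It is assumed that g is non-zero (for D={0}, b=1, a=0 every configuration is a covering and the claim fails), and ''the d-th cyclotomic polynomial'' is read as φ_d=1+t+...+t^{d-1}, since with the irreducible one the claim is false. *)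

(* Defs.v *)
From HB Require Import structures.
From mathcomp Require Import all_boot all_order all_algebra.
From mathcomp Require Import finmap.
From mathcomp Require Import boolp classical_sets reals.
From mathcomp Require Import complex.
From mathcomp Require Import monalg.

Set Implicit Arguments.
Unset Strict Implicit.
Unset Printing Implicit Defensive.

Import Order.TTheory GRing.Theory Num.Theory.

Local Open Scope fset_scope.
Local Open Scope classical_set_scope.
Local Open Scope ring_scope.

Notation Z2 := (int * int)%type.

Definition dot (u w : Z2) : int := u.1 * w.1 + u.2 * w.2.

Definition perp (v : Z2) : Z2 := (v.2, - v.1).

Definition parallel (v w : Z2) : Prop := dot v (perp w) = 0.

Definition primitive (v : Z2) : bool := coprimez v.1 v.2.

Definition on_line (v w : Z2) : Prop := exists k : int, w = v *~ k.

Definition toR2 (R : realType) (u : Z2) : (R^o * R^o)%type :=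
  (u.1%:~R, u.2%:~R).

Definition conv_hull (R : realType) (D : {fset Z2}) : set (R^o * R^o)%type :=
  [set p | exists l : Z2 -> R,
     [/\ forall w, 0 <= l w,
         \sum_(w <- D) l w = 1 &
         p = \sum_(w <- D) l w *: toR2 R w]].

Definition convex (R : realType) (D : {fset Z2}) : Prop :=
  [set` D] = [set u : Z2 | conv_hull D (toR2 R u)].

Definition outer_edge (S : {fset Z2}) (v : Z2) : Prop :=
  exists t : Z2,
    (forall u, u \in S -> 0 <= dot (u - t) (perp v)) /\
    (2 <= #|` [fset u in S | dot (u - t)%R (perp v) == 0%R] |)%N.

(* Laurent polynomials in x, y over the complex numbers, as finitely supported
   coefficient families: [<< z *g u >>] is z X^u, [g@_u] the coefficient of X^u
   and [msupp g] the support. *)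
Notation lpoly R := {malg R[i][Z2]}.

Definition shape_poly (R : realType) (D : {fset Z2}) : lpoly R :=
  \sum_(u <- D) << 1 *g (- u) >>.

Definition covering_poly (R : realType) (D : {fset Z2}) (b a : nat) : lpoly R :=
  shape_poly R D - << b%:R - a%:R *g 0 >>.

Definition edge_directions (R : realType) (g : lpoly R) : set Z2 :=
  [set v | primitive v /\ outer_edge (msupp g) v].

Definition fiber (R : realType) (g : lpoly R) (v u : Z2) : lpoly R :=
  \sum_(w <- msupp g | `[< on_line v (w - u) >]) << g@_w *g w >>.

(* p = X^u (q_0 + q_1 X^v + ... + q_n X^(nv)) with q_0 <> 0; the leading
   coefficient of [q] is non-zero by the definition of [{poly _}]. *)
Definition is_normal_form (R : realType) (v : Z2) (p : lpoly R)
    (q : {poly R[i]}) : Prop :=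
  q`_0 != 0 /\
  exists u : Z2, p = \sum_(k < size q) << q`_k *g (u + v *+ k) >>.

(* The default value makes 0 the normal form of the zero polynomial: the fiber
   through the origin, used in [fib] below, can vanish. *)
Definition normal_form (R : realType) (v : Z2) (p : lpoly R) : {poly R[i]} :=
  xget 0 [set q | is_normal_form v p q].

Definition fibers (R : realType) (g : lpoly R) (v : Z2) : set {poly R[i]} :=
  [set normal_form v (fiber g v u) | u in [set u | fiber g v u != 0]].

Definition fibers' (R : realType) (g : lpoly R) (v : Z2) : set {poly R[i]} :=
  [set normal_form v (fiber g v u)
     | u in [set u | ~ on_line v u /\ fiber g v u != 0]].

Definition fib (R : realType) (g : lpoly R) (v : Z2) : {poly R[i]} :=
  normal_form v (fiber g v 0).

(* [phi R 0] is the empty sum 0. *)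
Definition phi (R : realType) (n : nat) : {poly R[i]} := \sum_(i < n) 'X^i.

Definition phi_family (R : realType) (F : set {poly R[i]}) (ns : seq nat) :
    Prop :=
  all (leq 1) ns /\ F = [set phi R n | n in [set` ns]].

(* gcd (n_1, ..., n_r) where F = {phi_{n_1}, ..., phi_{n_r}}. The list of
   indices is unique up to order and repetition. For F empty the value is
   gcd () = 0. *)
Definition phi_gcd (R : realType) (F : set {poly R[i]}) : nat :=
  \big[gcdn/0%N]_(n <- xget [::] [set ns | phi_family F ns]) n.

(* "The d-th cyclotomic polynomial" is the greatest common divisor
   phi_d = 1 + t + ... + t^(d-1) of phi_{n_1}, ..., phi_{n_r}, not the minimal
   polynomial Phi_d of a primitive d-th root of unity: only phi_1 = 1 makes the
   condition automatic for d = 1, and Phi_d does not suffice for composite d. *)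
Definition no_common_factor (R : realType) (g : lpoly R) (v : Z2) : Prop :=
  coprimep (phi R (phi_gcd (fibers' g v))) (fib g v).

Definition configuration : Type := Z2 -> bool.

Definition covering (D : {fset Z2}) (b a : nat) (c : configuration) : Prop :=
  forall u : Z2,
    #|` [fset w in [fset u + t | t in D] | c w] | = if c u then b else a.

Definition periodic_by (c : configuration) (t : Z2) : Prop :=
  forall u : Z2, c (u + t) = c u.

Definition periodic (c : configuration) : Prop :=
  exists2 t : Z2, t != 0 & periodic_by c t.

Definition two_periodic (c : configuration) : Prop :=
  exists s t : Z2, [/\ ~ parallel s t, periodic_by c s & periodic_by c t].

(* Main.v *)
(* For a covering c, the Laurent polynomial g has integer coefficients and g c is
   constant, so g annihilates e = X^w c - c for every w.

   By Frobenius, g(X^p) e = g^p e = 0 modulo p, and e is bounded, so g(X^p) e = 0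
   for all large primes p; hence g(X^n) e = 0 for all n = 1 mod q, for some q > 0.
   A Vandermonde elimination among these relations shows that e is annihilated by
   a product of differences X^(q s0) - X^(q s), where s0 is a fixed and s runs over
   the other points of the support of g.

   These factors are removed one at a time.  Multiplying e by all the other
   factors yields a configuration annihilated by g and with a period k v, v
   primitive.  Splitting X^(kv) - 1 over the complex numbers, one may assume that
   X^v acts as a root of unity zeta; then g becomes a one-dimensional recurrence
   whose coefficients are the values at zeta of the fibers of g.  If they are not
   all 0, finitely many values and determinism force a second period, and the
   factor can be replaced by X^(Mw) - 1 for any prescribed w.  In the end only
   such factors remain and c is periodic along w.

   The values at zeta are not all 0 when v is not the direction of an outer edge
   (the extreme fiber is a monomial), and otherwise by the gcd conditions, since
   convexity of D makes the fibers phi_n. *)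

Require Import Defs.
From HB Require Import structures.
From mathcomp Require Import all_boot all_order all_algebra.
From mathcomp Require Import finmap.
From mathcomp Require Import boolp classical_sets reals.
From mathcomp Require Import complex.
From mathcomp Require Import monalg.
From mathcomp Require Import functions.
From mathcomp Require Import ring zify.

Set Implicit Arguments.
Unset Strict Implicit.
Unset Printing Implicit Defensive.

Import Order.TTheory GRing.Theory Num.Theory.

Local Open Scope fset_scope.
Local Open Scope classical_set_scope.
Local Open Scope ring_scope.

(** * Dilations of an annihilating relation *)

Lemma iter_addB (V : zmodType) (A B : V -> V) (n : nat) (x : V) :
  additive A -> additive B -> (forall y, A (B y) = B (A y)) ->
  iter n (fun y => A y + B y) x
  = \sum_(i < n.+1) iter (n - i) A (iter i B x) *+ 'C(n, i).
Proof.
move=> Aadd Badd AB.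
pose a := GRing.isAdditive.Build V V A Aadd.
pose fA : {additive V -> V} := HB.pack A a.
pose b := GRing.isAdditive.Build V V B Badd.
pose fB : {additive V -> V} := HB.pack B b.
have AMn k y : A (y *+ k) = A y *+ k by exact: (raddfMn fA).
have BMn k y : B (y *+ k) = B y *+ k by exact: (raddfMn fB).
have AiB i y : iter i A (B y) = B (iter i A y).
  by elim: i => //= i ->.
elim: n => [|n IHn]; first by rewrite big_ord_recl big_ord0 addr0.
rewrite iterS {}IHn -[A _]/(fA _) -[B _]/(fB _) !raddf_sum.
rewrite [X in X + _]big_ord_recl [X in _ + X]big_ord_recr.
rewrite [RHS]big_ord_recl big_ord_recr /=.
rewrite !binn !subnn !subn0 !bin0 -!addrA; congr (_ + _).
rewrite addrA -big_split /=; congr (_ + _).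
apply: eq_bigr => i _; rewrite -[bump 0 i]/i.+1 AMn BMn subSS binS mulrnDr.
congr (_ + _).
  by rewrite -[A _]/(iter (n - i.+1).+1 A _) -subSn ?subSS.
by rewrite /= AiB.
Qed.

(** The inner binomial coefficients are divisible by [p]. The Frobenius identity is put in terms of
    operators because it is applied to translations. *)
Lemma iter_add_prime (p : nat) (V : zmodType) (A B : V -> V) (x : V) :
  prime p -> (forall y : V, y *+ p = 0) ->
  additive A -> additive B -> (forall y, A (B y) = B (A y)) ->
  iter p (fun y => A y + B y) x = iter p A x + iter p B x.
Proof.
move=> p_pr Vp Aadd Badd AB; rewrite (iter_addB p x Aadd Badd AB).
case: p p_pr Vp => // p p_pr Vp.
rewrite big_ord_recl big_ord_recr /= -[bump 0 p]/p.+1 subnn bin0 binn.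
rewrite big1 ?add0r // => i _.
have /dvdnP[k ->] : (p.+1 %| 'C(p.+1, bump 0 i))%N.
  by rewrite prime_dvd_bin //= /bump /=; have := ltn_ord i; lia.
by rewrite mulrnA Vp.
Qed.

(** The action of a Laurent polynomial given by its list of terms, X^s translating the argument by
    [s]. With lists, dilation is a [map] and terms can be split off by induction. *)
Definition lact (V : zmodType) (L : seq (Z2 * int)) (e : Z2 -> V) : Z2 -> V :=
  fun x => \sum_(l <- L) e (x + l.1) *~ l.2.

(** Translations commute, so in characteristic [p] the p-th power is taken term by term; by Fermat's
    little theorem the integer coefficients stay the same. *)
Lemma lact_prime (p : nat) (L : seq (Z2 * int)) (e : Z2 -> 'F_p) :
  prime p -> iter p (lact L) e = lact [seq (l.1 *+ p, l.2) | l <- L] e.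
Proof.
move=> p_pr; elim: L => [|[s z] L IH].
  (* Positivity of [p] matters for the empty list: [iter 0] is the identity, not zero. *)
  case: p p_pr e => // p p_pr e /=; apply/funext => x.
  by rewrite /lact !big_nil.
have lactadd : additive (lact L : (Z2 -> 'F_p) -> (Z2 -> 'F_p)).
  move=> f h; apply/funext => x; rewrite /lact.
  rewrite -[RHS]/(_ - _) -sumrB; apply: eq_bigr => l _.
  by rewrite -mulrzBl.
pose A (f : Z2 -> 'F_p) : Z2 -> 'F_p := fun x => f (x + s) *~ z.
have Aadd : additive A.
  by move=> f h; apply/funext => x; rewrite /A -[RHS]/(_ - _) -mulrzBl.
have -> : lact ((s, z) :: L) = (fun f : Z2 -> 'F_p => A f + lact L f).
  by apply/funext => f; apply/funext => x; rewrite /lact big_cons.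
rewrite (iter_add_prime _ p_pr) //.
- rewrite IH; apply/funext => x; rewrite /lact /= big_cons /=.
  congr (_ + _).
  suff E n y : iter n A e y = e (y + s *+ n) * z%:~R ^+ n.
    have zp := rmorph_int (pFrobenius_aut (pchar_Fp p_pr)) z.
    by rewrite E -[_ ^+ p]/(pFrobenius_aut (pchar_Fp p_pr) _) zp mulrzr.
  elim: n y => [|n IHn] y; first by rewrite addr0 mulr1.
  by rewrite iterS /A IHn -addrA -mulrS -mulrzr exprSr mulrA.
- move=> f; apply/funext => x; rewrite -[RHS]/(0 : 'F_p).
  have fMn n : (f *+ n) x = f x *+ n.
    by elim: n => // n IHn; rewrite !mulrS -IHn.
  rewrite fMn.
  by rewrite -mulr_natr (pcharf0 (pchar_Fp p_pr)) mulr0.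
- move=> f; apply/funext => x; rewrite /A /lact mulrz_suml.
  by apply: eq_bigr => l _; rewrite -mulrzA mulrC mulrzA addrAC.
Qed.

(** Frobenius gives the dilated relation modulo [p]; the sum is smaller than [p] in absolute value,
    hence zero. *)
Lemma lact_dilate_prime (p : nat) (L : seq (Z2 * int)) (e : Z2 -> int)
    (B : nat) :
  prime p -> (forall x, `|e x| <= B)%N -> (B * \sum_(l <- L) `|l.2| < p)%N ->
  (forall x, lact L e x = 0) ->
  forall x, lact [seq (l.1 *+ p, l.2) | l <- L] e x = 0.
Proof.
move=> p_pr eB Bp e0 x.
pose f (y : Z2) : 'F_p := (e y)%:~R.
have castL M y : lact M f y = (lact M e y)%:~R.
  rewrite /lact /f raddf_sum /=; apply: eq_bigr => l _.
  by rewrite mulrzz intrM mulrzr.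
have : (lact [seq (l.1 *+ p, l.2) | l <- L] e x)%:~R = 0 :> 'F_p.
  rewrite -castL -lact_prime //; case: p p_pr {Bp} f castL => // p _ f castL.
  rewrite iterSr; have -> : lact L f = fun=> 0.
    by apply/funext => y; rewrite castL e0.
  have Z n : iter n (lact L) (fun=> 0 : 'F_p.+1) = fun=> 0.
    elim: n => //= n ->; apply/funext => y; rewrite /lact big1 // => l _.
    exact: mul0rz.
  by rewrite Z.
set t := lact _ e x => /eqP; rewrite -(dvdz_pcharf (pchar_Fp p_pr)) => ptz.
have tB : (`|t| <= B * \sum_(l <- L) `|l.2|)%N.
  rewrite /t /lact big_map big_distrr /=.
  apply: (big_ind2 (fun (a : int) (b : nat) => (`|a| <= b)%N)) => //.
    by move=> *; lia.
  by move=> l _; rewrite mulrzz abszM leq_mul2r eB orbT.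
apply/eqP; rewrite -absz_eq0; apply: contraTT ptz => t0.
rewrite dvdzE absz_nat; apply/negP => /dvdn_leq; lia.
Qed.

(** The prime factors of [n] are applied one after another. Dilation preserves the coefficients, so
    the same bound serves at each stage. *)
Lemma lact_dilate (n : nat) (L : seq (Z2 * int)) (e : Z2 -> int) (B : nat) :
  (0 < n)%N -> (forall x, `|e x| <= B)%N ->
  (forall p, prime p -> p %| n -> B * \sum_(l <- L) `|l.2| < p)%N ->
  (forall x, lact L e x = 0) ->
  forall x, lact [seq (l.1 *+ n, l.2) | l <- L] e x = 0.
Proof.
elim/ltn_ind: n L => n IH L n0 eB Bn e0.
have [n1 | n1] := leqP n 1.
  have -> : n = 1%N by lia.
  by move=> x; rewrite -(e0 x) /lact big_map; apply: eq_bigr => l _.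
have p_pr := pdiv_prime n1; set p := pdiv n in p_pr.
have /dvdnP[m nE] : (p %| n)%N := pdiv_dvd n.
have p1 := prime_gt1 p_pr.
have -> : [seq (l.1 *+ n, l.2) | l <- L]
        = [seq (l.1 *+ m, l.2) | l <- [seq (l.1 *+ p, l.2) | l <- L]].
  by rewrite -map_comp; apply: eq_map => l /=; rewrite -mulrnA mulnC -nE.
have m0 : (0 < m)%N by move: n0; rewrite nE; case: (m).
apply: IH => //; first by rewrite nE; nia.
- move=> q q_pr qm; rewrite big_map /=; apply: Bn => //.
  by rewrite nE; apply: dvdn_mulr.
apply: (lact_dilate_prime p_pr eB) => //; apply: Bn => //; exact: pdiv_dvd.
Qed.

(** For [q] the factorial of the bound, no prime up to the bound divides 1 + k q. *)
Lemma lact_dilate_fact (L : seq (Z2 * int)) (e : Z2 -> int) (B : nat) :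
  (forall x, `|e x| <= B)%N -> (forall x, lact L e x = 0) ->
  exists2 q, (0 < q)%N &
    forall k x, lact [seq (l.1 *+ (1 + k * q)%N, l.2) | l <- L] e x = 0.
Proof.
move=> eB e0; exists ((B * \sum_(l <- L) `|l.2|)`!)%N; first exact: fact_gt0.
move=> k; apply: (lact_dilate _ eB) => // p p_pr pn; rewrite ltnNge.
apply: contraL pn => pB.
have /(dvdn_mull k) pq : (p %| (B * \sum_(l <- L) `|l.2|)`!)%N.
  by apply: dvdn_fact; rewrite prime_gt0.
by rewrite dvdn_addl // dvdn1; case: eqP p_pr => // ->.
Qed.

(* [X^u1] times the [k]-th relation minus the [k+1]-st one has no term in [u1]:
   a Vandermonde elimination. *)
Lemma shift_elimination (V : zmodType) (L : seq (Z2 * (Z2 -> V))) (u0 : Z2)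
    (c0 : Z2 -> V) :
  (forall k x, c0 (x + u0 *+ k) + \sum_(l <- L) l.2 (x + l.1 *+ k) = 0) ->
  forall x, foldl (fun d u y => d (y + u0) - d (y + u)) c0 (unzip1 L) x = 0.
Proof.
have [n] := ubnP (size L); elim: n => // n IH in L c0 *.
case: L => [|[u c] L] sL H x /=.
  by have := H 0%N x; rewrite big_nil !addr0.
pose L' := [seq (l.1, fun y => l.2 (y + l.1) - l.2 (y + u)) | l <- L].
have -> : unzip1 L = unzip1 L' by rewrite /unzip1 -map_comp; apply: eq_map.
apply: IH => [|k y]; first by rewrite size_map.
have sE (w : Z2) : y + w *+ k + w = y + w *+ k.+1 by rewrite mulrSr addrA.
have cE (w : Z2) : y + w *+ k + u = y + u + w *+ k by rewrite addrAC.
have -> : \sum_(l <- L') l.2 (y + l.1 *+ k)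
        = \sum_(l <- L) l.2 (y + l.1 *+ k.+1)
          - \sum_(l <- L) l.2 (y + u + l.1 *+ k).
  rewrite big_map -sumrB; apply: eq_bigr => l _ /=.
  by rewrite sE cE.
have := H k.+1 y; have := H k (y + u); rewrite !big_cons /= -(cE u) sE.
have swap (a b d f g : V) : a - b + (d - f) = (a + (g + d)) - (b + (g + f)).
  by rewrite !(addrCA _ g) (addrC g) addrKA opprD addrACA.
set t := c _; rewrite sE (cE u0) (swap _ _ _ _ t); move=> H0 H1.
by rewrite H0 H1 subr0.
Qed.

(** * Periods from recurrences *)

Definition finitely_valued (T : eqType) (e : Z2 -> T) : Prop :=
  exists s : seq T, forall x, e x \in s.

Lemma finitely_valued2 (T U W : eqType) (F : T -> U -> W)
    (e : Z2 -> T) (f : Z2 -> U) (u v : Z2) :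
  finitely_valued e -> finitely_valued f ->
  finitely_valued (fun x => F (e (x + u)) (f (x + v))).
Proof.
move=> [s es] [t ft]; exists [seq F a b | a <- s, b <- t] => x.
exact: allpairs_f.
Qed.

Lemma finitely_valued_shift2 (T : eqType) (F : T -> T -> T) (e : Z2 -> T)
    (u : Z2) :
  finitely_valued e -> finitely_valued (fun x => F (e (x + u)) (e x)).
Proof.
move=> [s es]; exists [seq F a b | a <- s, b <- s] => x.
exact: allpairs_f.
Qed.

(* Among [K + 1] consecutive windows of [n] values along [y], ending at [x],
   two coincide, where [K] is the number of possible windows; the
   coincidence propagates forward to [x]. *)
Lemma deterministic_periodic (T : eqType) (e : Z2 -> T) (y : Z2) (n : nat) :
  finitely_valued e ->
  (forall x x', (forall i, (i < n)%N -> e (x + y *+ i) = e (x' + y *+ i)) ->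
    e (x + y *+ n) = e (x' + y *+ n)) ->
  exists2 N, (0 < N)%N & forall x, e (x + y *+ N) = e x.
Proof.
move=> [s es] det.
have idx_lt x : (index (e x) s < size s)%N by rewrite index_mem.
pose state x := [ffun i : 'I_n => Ordinal (idx_lt (x + y *+ i))].
have det_state x x' : state x = state x' ->
    forall m, e (x + y *+ m) = e (x' + y *+ m).
  move=> /ffunP xx' m.
  elim/ltn_ind: m => m IHm; case: (ltnP m n) => mn.
    have := xx' (Ordinal mn); rewrite !ffunE => -[] /= eq_idx.
    by rewrite -(nth_index (e x) (es (x + y *+ m))) eq_idx nth_index.
  have E (z : Z2) : z + y *+ m = z + y *+ (m - n) + y *+ n.
    by rewrite -addrA -mulrnDr subnK.
  rewrite !E; apply: det => i i_lt; rewrite -!addrA -!mulrnDr.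
  by apply: IHm; lia.
pose K := #|{: {ffun 'I_n -> 'I_(size s)}}|.
exists K`!%N => [|x]; first exact: fact_gt0.
pose w (j : 'I_K.+1) := state (x - y *+ j).
have /injectivePn[i [j ij wij]] : ~~ injectiveb w.
  apply/negP => /injectiveP /leq_card; rewrite card_ord.
  by rewrite -/K ltnn.
wlog ltij : i j ij wij / (i < j)%N.
  move=> W; case: (ltngtP i j) => [||eij]; first exact: (W i j).
    by apply: (W j i) => //; rewrite eq_sym.
  by case/eqP: ij; apply/val_inj.
have step m : e (x + y *+ m + y *+ (j - i)) = e (x + y *+ m).
  have := det_state _ _ wij (j + m)%N.
  have -> : x - y *+ j + y *+ (j + m) = x + y *+ m.
    by rewrite mulrnDr addrA subrK.
  move=> <-; congr e; rewrite -!addrA; congr (_ + _).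
  rewrite -mulrnDr -[(_ + (j - i))%N](addnK i) mulrnBr ?leq_addl //.
  by rewrite addrC; congr (y *+ _ - _); lia.
have /dvdnP[q ->] : (j - i %| K`!)%N by apply: dvdn_fact; have := ltn_ord j; lia.
elim: q => [|q IHq]; first by rewrite addr0.
by rewrite mulSn addnC mulrnDr addrA step.
Qed.

Lemma periodMn (T : Type) (e : Z2 -> T) (y : Z2) (N k : nat) :
  (forall x, e (x + y *+ N) = e x) -> forall x, e (x + y *+ (N * k)) = e x.
Proof.
move=> eN x; elim: k => [|k IH]; first by rewrite muln0 addr0.
by rewrite mulnS addnC mulrnDr addrA eN.
Qed.

Lemma periodMz (T : Type) (e : Z2 -> T) (y : Z2) (k : int) :
  (forall x, e (x + y) = e x) -> forall x, e (x + y *~ k) = e x.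
Proof.
move=> ey x.
have H (n : nat) z : e (z + y *+ n) = e z.
  by have := @periodMn _ e y 1 n ey z; rewrite mul1n.
case: k => n; first by rewrite -pmulrn H.
by rewrite NegzE mulrNz -pmulrn -[in RHS](subrK (y *+ n.+1) x) H.
Qed.

(** The product of X^(My) - 1 and X^(Ny) - 1 kills [e], a deterministic recurrence of length N + M;
    finitely many values exclude linear growth. Each removal of a factor ends with this lemma. *)
Lemma finitely_valued_period_period (V : zmodType) (e : Z2 -> V) (y : Z2)
    (M N : nat) :
  (0 < M)%N -> (0 < N)%N -> finitely_valued e ->
  (forall x, e (x + y *+ N + y *+ M) - e (x + y *+ N) = e (x + y *+ M) - e x) ->
  exists2 K, (0 < K)%N & forall x, e (x + y *+ K) = e x.
Proof.
move=> M0 N0 fe H; apply: (deterministic_periodic (n := N + M) fe) => x x' xx'.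
rewrite !mulrnDr !addrA.
have E z : e (z + y *+ N + y *+ M) = e (z + y *+ N) + (e (z + y *+ M) - e z).
  by rewrite -H [RHS]addrC subrK.
have := xx' 0%N; rewrite !addr0 => x0.
by rewrite !E !xx' ?x0 //; lia.
Qed.

Lemma recurrence_periodic (F : fieldType) (P : {poly F}) (e : Z2 -> F) (y : Z2) :
  P != 0 -> finitely_valued e ->
  (forall x, \sum_(i < size P) P`_i * e (x + y *+ i) = 0) ->
  exists2 N, (0 < N)%N & forall x, e (x + y *+ N) = e x.
Proof.
move=> P0 fe H; apply: (deterministic_periodic (n := (size P).-1) fe) => x x' xx'.
have lP : lead_coef P != 0 by rewrite lead_coef_eq0.
have sP : size P = (size P).-1.+1 by rewrite prednK // size_poly_gt0.
apply: (mulfI lP); rewrite lead_coefE.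
have := H x'; have := H x; rewrite sP !big_ord_recr /= => /eqP Hx /eqP Hx'.
move: Hx Hx'; rewrite addrC addr_eq0 => /eqP ->.
rewrite addrC addr_eq0 => /eqP ->; congr (- _).
by apply: eq_bigr => i _; rewrite xx'.
Qed.

(** * Lattice bases and specialization of X^v at a scalar *)

Definition cross (v w : Z2) : int := dot v (perp w).

Lemma crossE (v w : Z2) : cross v w = v.1 * w.2 - v.2 * w.1.
Proof. by rewrite /cross /dot /perp /= mulrN. Qed.

Lemma Z2_mulrzE (v : Z2) (k : int) : v *~ k = (v.1 * k, v.2 * k).
Proof.
case: v => a b; have H (n : nat) : (a, b) *+ n = (a * n%:Z, b * n%:Z) :> Z2.
  elim: n => [|n IH]; first by rewrite mulr0n !mulr0.
  by rewrite mulrS IH; congr (_, _) => /=; lia.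
by case: k => n; rewrite ?NegzE ?mulrNz -?pmulrn H //= !mulrN.
Qed.

Lemma basis_coord (v y s : Z2) : cross v y = 1 ->
  s = v *~ cross s y + y *~ cross v s.
Proof.
move: v y s => [v1 v2] [y1 y2] [s1 s2]; rewrite !crossE !Z2_mulrzE /= => vy.
by congr (_, _); rewrite /= -[LHS]mulr1 -vy; ring.
Qed.

(* Coordinates in the basis [(v, y)] turn each fiber into a Laurent polynomial in
   [X^v]; this is its value at [X^v = zeta] for the fiber [cross v s = beta]. *)
Definition fiber_at (F : fieldType) (S : seq Z2) (z : Z2 -> F) (v y : Z2)
    (zeta : F) (beta : int) : F :=
  \sum_(s <- S | cross v s == beta) z s * zeta ^ cross s y.

(* Setting [X^v = zeta] turns the relation into a scalar recurrence along [y]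
   whose coefficients are the values of the fibers at [zeta]. *)
Lemma eigen_periodic (F : fieldType) (S : seq Z2) (z : Z2 -> F) (v y : Z2)
    (zeta : F) (beta : int) (e : Z2 -> F) :
  cross v y = 1 -> zeta != 0 -> fiber_at S z v y zeta beta != 0 ->
  finitely_valued e -> (forall x, e (x + v) = zeta * e x) ->
  (forall x, \sum_(s <- S) z s * e (x + s) = 0) ->
  exists2 N, (0 < N)%N & forall x, e (x + y *+ N) = e x.
Proof.
move=> vy zeta0 fib0 fe ev e0.
have evz (k : int) x : e (x + v *~ k) = zeta ^ k * e x.
  have evn (n : nat) w : e (w + v *+ n) = zeta ^+ n * e w.
    elim: n w => [|n IH] w; first by rewrite addr0 mul1r.
    by rewrite mulrSr addrA ev IH exprS mulrA.
  case: k => n; first by rewrite -pmulrn evn.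
  rewrite NegzE mulrNz -pmulrn; apply: (mulfI (expf_neq0 n.+1 zeta0)).
  by rewrite -evn subrK mulrA -exprnN mulfV ?mul1r // expf_neq0.
(* All heights [cross v s], and [beta], lie between -m and m; adding m turns them into polynomial
   indices from 0 to 2m. *)
pose m := (\sum_(s <- S) `|cross v s| + `|beta|)%N.
pose r (i : nat) := fiber_at S z v y zeta (i%:Z - m%:Z).
have mS s : s \in S -> (`|cross v s| <= m)%N.
  by move=> sS; rewrite /m (big_rem s sS) /= -addnA leq_addr.
pose P := \poly_(i < (m + m).+1) r i.
have P0 : P != 0.
  apply/eqP => /(congr1 (coefp (absz (beta + m%:Z)))); rewrite /= coef_poly coef0.
  have -> : (`|(beta + m%:Z)%R| < (m + m).+1)%N by rewrite /m; lia.
  rewrite /r; have -> : `|(beta + m%:Z)%R|%N%:Z - m%:Z = beta by rewrite /m; lia.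
  by move/eqP; apply/negP.
apply: (recurrence_periodic P0 fe) => x.
have -> : \sum_(i < size P) P`_i * e (x + y *+ i)
   = \sum_(i < (m + m).+1) r i * e (x + y *+ i).
  rewrite (big_ord_widen _ (fun i => P`_i * e (x + y *+ i)) (size_poly _ _)).
  rewrite big_mkcond; apply: eq_bigr => i _; rewrite coef_poly ltn_ord.
  case: ltnP => // /(nth_default 0); rewrite coef_poly ltn_ord => ->.
  by rewrite mul0r.
(* The relation at x + m y compensates the shift of indices; its terms are then grouped by
   height. *)
rewrite -[RHS](e0 (x + y *+ m)) /r /fiber_at.
under eq_bigr => i _ do rewrite mulr_suml big_mkcond.
rewrite exchange_big /=; apply: eq_big_seq => s sS.
have := mS s sS => ms.
have lt_i : (absz (cross v s + m%:Z)%R < (m + m).+1)%N by lia.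
rewrite (bigD1 (Ordinal lt_i)) //= big1 => [|i].
  have -> : `|(cross v s + m%:Z)%R|%N%:Z - m%:Z = cross v s by lia.
  rewrite eqxx addr0 -mulrA; congr (_ * _).
  have -> : x + y *+ m + s
      = x + y *+ absz (cross v s + m%:Z)%R + v *~ cross s y.
    rewrite [in LHS](basis_coord s vy) [LHS]addrCA [LHS]addrC; congr (_ + _).
    rewrite -addrA (pmulrn y m) (pmulrn y (absz _)); congr (_ + _).
    rewrite addrC -mulrzDr; congr (_ *~ _); lia.
  by rewrite evz.
rewrite -val_eqE /= => /eqP ne; case: eqP => // E; exfalso; apply: ne.
by rewrite E; lia.
Qed.

Definition eigen_prod (F : fieldType) (v : Z2) (zs : seq F) (e : Z2 -> F) :
    Z2 -> F :=
  foldl (fun d zeta x => d (x + v) - zeta * d x) e zs.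

(** By induction (X^v - zeta) e has a period N y. Then (X^(Ny) - 1) e is an eigenfunction of X^v for
    zeta, periodic by [eigen_periodic], and the two periods combine. *)
Lemma eigen_prod_periodic (F : fieldType) (S : seq Z2) (z : Z2 -> F) (v y : Z2)
    (zs : seq F) (e : Z2 -> F) :
  cross v y = 1 ->
  (forall zeta, zeta \in zs ->
     zeta != 0 /\ exists beta, fiber_at S z v y zeta beta != 0) ->
  finitely_valued e -> (forall x, eigen_prod v zs e x = 0) ->
  (forall x, \sum_(s <- S) z s * e (x + s) = 0) ->
  exists2 N, (0 < N)%N & forall x, e (x + y *+ N) = e x.
Proof.
move=> vy; elim: zs e => [|zeta zs IH] e Hzs fe ezs e0.
  by exists 1%N => // x; rewrite !(ezs _ : e _ = 0).
have [|||N N0 eN] := IH (fun x => e (x + v) - zeta * e x) _ _ ezs.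
- by move=> xi xi_zs; apply: Hzs; rewrite inE xi_zs orbT.
- exact: (finitely_valued_shift2 (fun a b => a - zeta * b) v fe).
- move=> x; under eq_bigr => s _ do rewrite mulrBr mulrCA addrAC.
  by rewrite sumrB -mulr_sumr !e0 mulr0 subrr.
have [zeta0 [beta fib0]] := Hzs zeta (mem_head _ _).
have [|||M M0 eM] := @eigen_periodic F S z v y zeta beta
    (fun x => e (x + y *+ N) - e x) vy zeta0 fib0.
- exact: (finitely_valued_shift2 (fun a b => a - b) (y *+ N) fe).
- move=> x; have := eN x; rewrite addrAC => /(canRL (subrK _)) ->; ring.
- move=> x; under eq_bigr => s _ do rewrite mulrBr addrAC.
  by rewrite sumrB !e0 subrr.
exact: (finitely_valued_period_period N0 M0 fe eM).
Qed.

Lemma eigen_prodE (F : fieldType) (v : Z2) (zs : seq F) (e : Z2 -> F) (n : nat)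
    (x : Z2) :
  (size zs < n)%N ->
  eigen_prod v zs e x
  = \sum_(i < n) (\prod_(zeta <- zs) ('X - zeta%:P))`_i * e (x + v *+ i).
Proof.
elim: zs e n => [|zeta zs IH] e n sz.
  case: n sz => // n _; rewrite big_ord_recl big_nil coef1 mul1r addr0.
  by rewrite big1 ?addr0 // => i _; rewrite coef1 mul0r.
case: n sz => // n; rewrite ltnS => sz.
rewrite /= big_cons (IH _ n sz); set p := \prod_(_ <- _) _.
have pn : p`_n = 0 by rewrite nth_default // size_prod_XsubC.
under [RHS]eq_bigr => i _ do rewrite mulrBl coefB coefXM coefCM mulrBl.
rewrite sumrB big_ord_recl /= mul0r add0r big_ord_recr /= pn mulr0 mul0r addr0.
rewrite -sumrB; apply: eq_bigr => i _.
by rewrite mulrBr -[bump 0 i]/i.+1 mulrS addrA [x + v + _]addrAC mulrA [_ * zeta]mulrC.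
Qed.

(** X^k - 1 splits into linear factors with non-zero roots, which reduces a period k v to
    [eigen_prod_periodic]. *)
Lemma fiber_periodic (F : closedFieldType) (S : seq Z2) (z : Z2 -> F)
    (v y : Z2) (k : nat) (e : Z2 -> F) :
  cross v y = 1 -> (0 < k)%N ->
  (forall zeta, zeta != 0 -> exists beta, fiber_at S z v y zeta beta != 0) ->
  finitely_valued e -> (forall x, e (x + v *+ k) = e x) ->
  (forall x, \sum_(s <- S) z s * e (x + s) = 0) ->
  exists2 N, (0 < N)%N & forall x, e (x + y *+ N) = e x.
Proof.
move=> vy k0 Hz fe ek e0.
have [zs zsE] := closed_field_poly_normal ('X^k - 1 : {poly F}).
rewrite lead_coefXnsubC // scale1r in zsE.
apply: (eigen_prod_periodic (zs := zs) vy _ fe _ e0) => [zeta zs_zeta|x].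
  suff zeta0 : zeta != 0 by split=> //; exact: Hz.
  have : root ('X^k - 1 : {poly F}) zeta by rewrite zsE root_prod_XsubC.
  move=> rz; apply/negP =>  /eqP z0; move: rz.
  rewrite z0 rootE !hornerE expr0n.
  by case: (k) k0 => // n _; rewrite /= sub0r oppr_eq0 oner_eq0.
have sz : size zs = k.
  have : size ('X^k - 1 : {poly F}) = (size zs).+1.
    by rewrite zsE size_prod_XsubC.
  by rewrite size_XnsubC // => -[->].
rewrite (eigen_prodE v e x (n := k.+1)) ?sz // -zsE.
rewrite big_ord_recr /= !coefB coefXn coef1 eqxx.
case: k k0 ek {zsE sz} => // k _ ek.
rewrite big_ord_recl /= !coefB coefXn coef1 /= big1 => [|i _].
  by rewrite sub0r subr0 mulN1r !addr0 subr0 mul1r ek addNr.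
rewrite !coefB coefXn coef1 -[bump 0 i]/i.+1 eqSS ltn_eqF ?ltn_ord //.
by rewrite subrr mul0r.
Qed.

Lemma primitive_decomposition (u : Z2) : u != 0 ->
  exists v y : Z2, exists2 k, (0 < k)%N & cross v y = 1 /\ u = v *+ k.
Proof.
case: u => a b u0; have [p [q pq]] := Bezoutz a b.
have g0 : gcdz a b != 0 by rewrite gcdz_eq0; apply: contraNN u0 => /andP[/eqP-> /eqP->].
have [a' aE] := dvdzP (dvdz_gcdl a b).
have [b' bE] := dvdzP (dvdz_gcdr a b).
have gE : (absz (gcdz a b))%:Z = gcdz a b by [].
move: (gcdz a b) g0 pq aE bE gE => g g0 pq aE bE gE.
exists (a', b'), (- q, p), (absz g); first by rewrite absz_gt0.
rewrite crossE /=; split.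
  apply: (mulIf g0); rewrite mul1r -[RHS]pq aE bE; ring.
by rewrite pmulrn Z2_mulrzE /= gE -aE -bE.
Qed.

(** * Removing the difference factors *)

Section AnnihilatedByIntegerPolynomial.

Variables (C : numClosedFieldType) (S : seq Z2) (z : Z2 -> int) (w : Z2).

Hypothesis fib_neq0 : forall (v y : Z2) (zeta : C),
  cross v y = 1 -> cross v w != 0 -> zeta != 0 ->
  exists beta, fiber_at S (fun s => (z s)%:~R) v y zeta beta != 0.

(** If [w] is parallel to [u], a multiple of [w] is a multiple of [u]. Otherwise there is a second,
    independent period along [y], and the lattice spanned by both contains a multiple of [w]. *)
Lemma period_toward (e : Z2 -> int) (u : Z2) :
  u != 0 -> finitely_valued e -> (forall x, e (x + u) = e x) ->
  (forall x, \sum_(s <- S) z s * e (x + s) = 0) ->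
  exists2 N, (0 < N)%N & forall x, e (x + w *+ N) = e x.
Proof.
move=> /primitive_decomposition[v [y [k k0 [vy ->]]]] fe ek e0.
have wE := basis_coord w vy.
have [vw|vw] := eqVneq (cross v w) 0.
  exists k => // x; rewrite wE vw mulr0z addr0 pmulrn -mulrzA mulrC mulrzA.
  rewrite -pmulrn.
  exact: periodMz.
have [||x|x|N N0 eN] := @fiber_periodic C S (fun s => (z s)%:~R) v y k
    (fun x => (e x)%:~R) vy k0.
- by move=> zeta; apply: fib_neq0.
- by case: fe => s es; exists [seq a%:~R | a <- s] => x; apply: map_f.
- by rewrite ek.
- rewrite -[RHS](_ : 0%:~R = _) // -(e0 x) raddf_sum /=.
  by apply: eq_bigr => s _; rewrite intrM.
have {}eN x : e (x + y *+ N) = e x by apply: (@intr_inj C).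
exists (k * N)%N => [|x]; first by rewrite muln_gt0 k0.
have -> : w *+ (k * N) = v *+ k *~ (cross w y * N%:Z)
                         + y *+ N *~ (cross v w * k%:Z).
  rewrite {1}wE mulrnDl !pmulrn -!mulrzA PoszM.
  by congr (_ *~ _ + _ *~ _); ring.
by rewrite addrA !periodMz.
Qed.

(** By induction (X^u0 - X^u) e has a period N w, so (X^(Nw) - 1) e has the non-zero period u0 - u,
    which [period_toward] trades for one along [w]. *)
Lemma period_of_product (us : seq Z2) (u0 : Z2) (e : Z2 -> int) :
  u0 \notin us -> finitely_valued e ->
  (forall x, \sum_(s <- S) z s * e (x + s) = 0) ->
  (forall x, foldl (fun d u y => d (y + u0) - d (y + u)) e us x = 0) ->
  exists2 N, (0 < N)%N & forall x, e (x + w *+ N) = e x.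
Proof.
elim: us e => [|u us IH] e u0us fe e0 /= eus.
  by exists 1%N => // x; rewrite !eus.
have /norP[u0u {}u0us] : ~~ ((u0 == u) || (u0 \in us)) by rewrite -in_cons.
have [||N N0 eN] := IH (fun x => e (x + u0) - e (x + u)) u0us _ _ eus.
- exact: (finitely_valued2 (fun a b => a - b) u0 u fe fe).
- move=> x; under eq_bigr => s _ do rewrite mulrBr ![_ + s + _]addrAC.
  by rewrite sumrB !e0 subrr.
have [||||M M0 eM] := @period_toward (fun x => e (x + w *+ N) - e x) (u0 - u).
- by rewrite subr_eq0.
- exact: (finitely_valued_shift2 (fun a b => a - b) (w *+ N) fe).
- move=> x; have := eN (x - u).
  have -> : x - u + w *+ N + u0 = x + (u0 - u) + w *+ N.
    by move: (w *+ N) => t; apply: injective_projections => /=; ring.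
  rewrite ![x - u + _]addrAC !subrK -[x + u0 - u]addrA addrK => /eqP.
  rewrite subr_eq -[X in _ == X]addrA [X in _ == X]addrC -subr_eq => /eqP ->.
  exact: addrC.
- move=> x; under eq_bigr => s _ do rewrite mulrBr [x + s + _]addrAC.
  by rewrite sumrB !e0 subrr.
exact: (finitely_valued_period_period N0 M0 fe eM).
Qed.

Lemma annihilated_periodic (e : Z2 -> int) (B : nat) :
  uniq S -> S != [::] -> (forall s, s \in S -> z s != 0) ->
  (forall x, `|e x| <= B)%N ->
  (forall x, \sum_(s <- S) z s * e (x + s) = 0) ->
  exists2 N, (0 < N)%N & forall x, e (x + w *+ N) = e x.
Proof.
move=> uS S0 zS eB e0.
have fe : finitely_valued e.
  exists [seq a%:Z - B%:Z | a <- iota 0 (B + B).+1] => x.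
  apply/mapP; exists (absz (e x + B%:Z)); have := eB x; last by lia.
  by rewrite mem_iota; lia.
have le0 x : lact [seq (s, z s) | s <- S] e x = 0.
  rewrite -[RHS](e0 x) /lact big_map; apply: eq_bigr => s _.
  by rewrite mulrzz mulrC.
have [q q0 dil] := lact_dilate_fact eB le0.
case SE : S uS S0 zS => [|s0 S'] // /andP[s0S' _] _ zS.
(* The exponent (1 + k q) s splits into s, absorbed into the function [c s], and k (q s), the form
   that [shift_elimination] expects. *)
pose c s x := e (x + s) *~ z s.
have rel k x : c s0 (x + s0 *+ q *+ k)
    + \sum_(l <- [seq (s *+ q, c s) | s <- S']) l.2 (x + l.1 *+ k) = 0.
  rewrite -[RHS](dil k x) SE /lact !big_map big_cons /c /=.
  have E (s : Z2) : x + s *+ (1 + k * q) = x + s *+ q *+ k + s.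
    by rewrite mulrnDr mulr1n mulnC mulrnA addrA addrAC.
  by rewrite E; congr (_ + _); apply: eq_bigr => s _; rewrite E.
have [||| N N0 cN] := period_of_product _ _ _ (shift_elimination rel).
- rewrite /unzip1 -map_comp; apply: contra s0S' => /mapP[s sS' /= sE].
  suff -> : s0 = s by [].
  move: sE; rewrite !pmulrn !Z2_mulrzE => -[E1 E2].
  have qn0 : q%:Z != 0 by case: (q) q0.
  by apply: injective_projections; apply: (mulIf qn0).
- exact: (finitely_valued2 (fun a b => a *~ z s0) s0 0 fe fe).
- move=> x; rewrite /c; under eq_bigr => s _ do rewrite addrAC mulrzAr.
  by rewrite -mulrz_suml e0 mul0rz.
exists N => // x; have := cN (x - s0); rewrite /c addrAC !subrK !mulrzz.
by move/(mulIf (zS _ (mem_head _ _))).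
Qed.

End AnnihilatedByIntegerPolynomial.

(** * Fibers and normal forms *)

Section LaurentPolynomials.

Variable R : realType.
Implicit Types (g p : lpoly R) (q : {poly R[i]}) (v y u w : Z2).

(** The linear extension of an arbitrary [F] from monomials; it serves both for evaluation at zeta
    and for the action on a configuration. *)
Definition lpoly_eval (F : Z2 -> R[i]) (p : lpoly R) : R[i] :=
  \sum_(w <- msupp p) p@_w * F w.

Lemma lpoly_eval_sub (F : Z2 -> R[i]) p (A : {fset Z2}) :
  (msupp p `<=` A)%fset -> lpoly_eval F p = \sum_(w <- A) p@_w * F w.
Proof.
move=> pA; rewrite /lpoly_eval (big_fset_incl _ pA) // => w _.
by move=> /mcoeff_outdom ->; rewrite mul0r.
Qed.

Lemma lpoly_evalD (F : Z2 -> R[i]) : {morph lpoly_eval F : p p' / p + p'}.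
Proof.
move=> p p'; rewrite (lpoly_eval_sub F (msuppD_le p p')).
rewrite (lpoly_eval_sub F (fsubsetUl (msupp p) (msupp p'))).
rewrite (lpoly_eval_sub F (fsubsetUr (msupp p) (msupp p'))).
by rewrite -big_split; apply: eq_bigr => w _; rewrite mcoeffD mulrDl.
Qed.

Lemma lpoly_eval0 (F : Z2 -> R[i]) : lpoly_eval F 0 = 0.
Proof. by rewrite /lpoly_eval msupp0 big_seq_fset0. Qed.

Lemma lpoly_evalU (F : Z2 -> R[i]) z w : lpoly_eval F << z *g w >> = z * F w.
Proof.
by rewrite (lpoly_eval_sub F msuppU_le) big_seq_fset1 mcoeffU eqxx.
Qed.

Lemma lpoly_eval_sum (F : Z2 -> R[i]) (I : Type) (r : seq I) (P : pred I)
    (G : I -> lpoly R) :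
  lpoly_eval F (\sum_(i <- r | P i) G i) = \sum_(i <- r | P i) lpoly_eval F (G i).
Proof. exact: (big_morph _ (lpoly_evalD F) (lpoly_eval0 F)). Qed.

Lemma lpoly_neq0 p : p != 0 -> exists w, p@_w != 0.
Proof.
move=> p0; apply: contrapT => /forallNP coef0; case/eqP: p0; apply/malgP => w.
by rewrite mcoeff0; apply/eqP/negP => pw; apply: (coef0 w); apply/negP.
Qed.

Lemma fiber_coef g v u w :
  (fiber g v u)@_w = if `[< on_line v (w - u) >] then g@_w else 0.
Proof.
rewrite /fiber raddf_sum /=.
under eq_bigr => t _ do rewrite mcoeffU.
have [wg | wg] := boolP (w \in msupp g); last first.
  rewrite (mcoeff_outdom wg) if_same big_seq_cond big1 // => t /andP[tg _].
  by case: eqP => // tw; rewrite tw (negPf wg) in tg.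
rewrite big_mkcond (bigD1_seq w) ?fset_uniq //= eq_refl big1 ?addr0 // => t tw.
by rewrite (negPf tw) mulr0n if_same.
Qed.

Lemma on_lineE v y w : cross v y = 1 -> on_line v w <-> cross v w = 0.
Proof.
move=> vy; split=> [[k ->]|vw]; first by rewrite Z2_mulrzE crossE /=; ring.
by exists (cross w y); rewrite {1}(basis_coord w vy) vw mulr0z addr0.
Qed.

Lemma primitive_basis v : primitive v <-> exists y, cross v y = 1.
Proof.
rewrite /primitive; split=> [/coprimezP[[p q] /= pq]|[y vy]].
  by exists (- q, p); rewrite crossE /= -pq; ring.
apply/coprimezP; exists (y.2, - y.1) => /=.
by rewrite -vy crossE; ring.
Qed.

Lemma cross1_mulr_inj v y : cross v y = 1 -> injective (fun k : int => v *~ k).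
Proof.
move=> vy j k /= jk; have : cross (v *~ j) y = cross (v *~ k) y by rewrite jk.
rewrite !crossE !Z2_mulrzE /= => E.
rewrite -[j]mul1r -[k]mul1r -vy crossE.
by rewrite mulrBl mulrAC [X in _ - X]mulrAC E; ring.
Qed.

Lemma normal_form_coef v y u p q (m : nat) : cross v y = 1 ->
  p = \sum_(k < size q) << q`_k *g (u + v *+ k) >> -> p@_(u + v *+ m) = q`_m.
Proof.
move=> vy ->; rewrite raddf_sum /=.
under eq_bigr => k _ do rewrite mcoeffU.
have inj (i j : nat) : (u + v *+ i == u + v *+ j) = (i == j).
  apply/eqP/eqP => [|-> //] /addrI; rewrite !pmulrn.
  by move=> /(cross1_mulr_inj vy) [].
have [mq | qm] := ltnP m (size q).
  rewrite (bigD1 (Ordinal mq)) //= eqxx big1 ?addr0 // => k km.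
  by rewrite inj; case: eqP => // E; case/eqP: km; apply: val_inj.
rewrite nth_default // big1 // => k _; rewrite inj.
by case: eqP => // E; have := ltn_ord k; rewrite E ltnNge qm.
Qed.

(** This keeps the choice in [normal_form] from falling back on its default. The base point is the
    first support point along the fiber. *)
Lemma normal_form_exists g v y u : cross v y = 1 -> fiber g v u != 0 ->
  exists q, is_normal_form v (fiber g v u) q.
Proof.
move=> vy; set f := fiber g v u => f0.
(* Since [cross v y = 1], a support point u + k v has |k| at most [M]; positions shifted by [M] are
   natural numbers, so a least one exists. *)
pose M := (\sum_(w <- msupp g) `|cross (w - u)%R y|)%N.
have fM (k : int) : (M < `|k|)%N -> f@_(u + v *~ k) = 0.
  move=> Mk; rewrite fiber_coef; case: ifP => // _.
  apply: mcoeff_outdom; apply: contraL Mk => wg; rewrite -leqNgt.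
  rewrite /M (big_rem _ wg) /= addrAC subrr add0r.
  apply: leq_trans (leq_addr _ _); rewrite Z2_mulrzE crossE /=.
  have -> : v.1 * k * y.2 - v.2 * k * y.1 = k * cross v y by rewrite crossE; ring.
  by rewrite vy mulr1.
have supp w : f@_w != 0 -> exists j : nat, w = u + v *~ (j%:Z - M%:Z).
  move=> fw; have := fw; rewrite fiber_coef; case: ifP; last by rewrite eqxx.
  move=> /asboolP[k wE] _.
  have {}wE : w = u + v *~ k by rewrite -wE addrC subrK.
  exists (absz (k + M%:Z)); rewrite wE; congr (_ + _ *~ _).
  have : ~~ (M < `|k|)%N by apply: contra fw => /fM; rewrite wE => ->.
  lia.
have exj : exists j : nat, f@_(u + v *~ (j%:Z - M%:Z)) != 0.
  have [w fw] := lpoly_neq0 f0.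
  by have [j wE] := supp w fw; exists j; rewrite -wE.
case: (ex_minnP exj) => j0 fj0 j0_min.
pose u0 := u + v *~ (j0%:Z - M%:Z).
pose q := \poly_(k < (M + M).+1) f@_(u0 + v *+ k).
have qE (k : nat) : q`_k = f@_(u0 + v *+ k).
  rewrite coef_poly; case: ltnP => // Mk; rewrite /u0 pmulrn -addrA -mulrzDr.
  by rewrite fM //; lia.
exists q; split; first by rewrite qE addr0.
exists u0; apply/malgP => w; rewrite [RHS]raddf_sum /=.
under [RHS]eq_bigr => k _ do rewrite mcoeffU.
have inj (i j : nat) : (u0 + v *+ i == u0 + v *+ j) = (i == j).
  apply/eqP/eqP => [|-> //] /addrI; rewrite !pmulrn.
  by move=> /(cross1_mulr_inj vy) [].
have [fw | fw] := eqVneq (f@_w) 0.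
  rewrite fw big1 // => k _; case: eqP => // kw.
  by rewrite qE kw fw.
have [j wE] := supp w fw.
have j0j : (j0 <= j)%N by apply: j0_min; rewrite -wE.
have {}wE : w = u0 + v *+ (j - j0).
  by rewrite wE /u0 pmulrn -addrA -mulrzDr; congr (_ + _ *~ _); lia.
rewrite wE -qE in fw *.
have jq : (j - j0 < size q)%N by rewrite ltnNge; apply: contra fw => /(nth_default 0) ->.
rewrite (bigD1 (Ordinal jq)) //= eqxx big1 ?addr0 // => k km.
by rewrite inj; case: eqP => // E; case/eqP: km; apply: val_inj.
Qed.

Lemma normal_formP g v y u : cross v y = 1 -> fiber g v u != 0 ->
  is_normal_form v (fiber g v u) (normal_form v (fiber g v u)).
Proof.
move=> vy /(normal_form_exists vy) ex.
exact: (xgetPex 0 (P := [set q | is_normal_form v (fiber g v u) q]) ex).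
Qed.

(** Each step along [v] multiplies by zeta, as [cross v y = 1], and the base point contributes a
    power of zeta: the fiber vanishes at zeta exactly when its normal form does. *)
Lemma normal_form_eval g v y u q (zeta : R[i]) :
  cross v y = 1 -> zeta != 0 -> is_normal_form v (fiber g v u) q ->
  exists k, fiber_at (msupp g) (fun s => g@_s) v y zeta (cross v u)
            = zeta ^ k * q.[zeta].
Proof.
move=> vy zeta0 [_ [u0 fE]]; exists (cross u0 y).
pose F s := zeta ^ cross s y.
have -> : fiber_at (msupp g) (fun s => g@_s) v y zeta (cross v u)
        = lpoly_eval F (fiber g v u).
  rewrite /fiber lpoly_eval_sum /fiber_at; apply: eq_big => [w|w _].
    apply/eqP/asboolP => [E|/(on_lineE _ vy)].
      by apply/(on_lineE _ vy); move: E; rewrite !crossE /=; lia.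
    by rewrite !crossE /=; lia.
  by rewrite lpoly_evalU.
rewrite fE lpoly_eval_sum horner_coef mulr_sumr; apply: eq_bigr => k _.
rewrite lpoly_evalU mulrCA /F; congr (_ * _).
have -> : cross (u0 + v *+ k) y = cross u0 y + k%:Z.
  rewrite pmulrn Z2_mulrzE -[in RHS](mul1r k%:Z) -vy !crossE /=; ring.
by rewrite expfzDr.
Qed.

End LaurentPolynomials.

(** * Coverings *)

Section Coverings.

Variables (R : realType) (D : {fset Z2}) (b a : nat).

Local Notation C := R[i].
Local Notation g := (covering_poly R D b a).

(** The coefficients of [g] as integers, so that they can be reduced modulo primes. The sign in
    [- s] reflects the exponents of [shape_poly]. *)
Definition covering_coef (s : Z2) : int :=
  (- s \in D)%:Z - (b%:Z - a%:Z) * (s == 0)%:Z.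

Lemma covering_polyE (s : Z2) : g@_s = (covering_coef s)%:~R.
Proof.
rewrite /covering_poly /shape_poly mcoeffB raddf_sum /= mcoeffU.
under eq_bigr => u _ do rewrite mcoeffU.
rewrite /covering_coef intrB intrM intrB; congr (_ - _); last first.
  by rewrite eq_sym; case: (s == 0); rewrite ?mulr1n ?mulr1 ?mulr0n ?mulr0.
have [sD | sD] := boolP (- s \in D).
  rewrite (bigD1_seq (- s)) ?fset_uniq //= opprK eq_refl big1 ?addr0 // => u us.
  by case: eqP => // E; case/eqP: us; rewrite -E opprK.
rewrite big_seq big1 // => u uD; case: eqP => // E.
by rewrite -E opprK uD in sD.
Qed.

Lemma covering_coef_sum (F : Z2 -> int) :
  \sum_(s <- msupp g) covering_coef s * F s
  = \sum_(t <- D) F (- t) - (b%:Z - a%:Z) * F 0.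
Proof.
apply: (@intr_inj C); rewrite raddf_sum raddfB raddf_sum /= intrM intrB.
transitivity (lpoly_eval (fun s => (F s)%:~R) g).
  by apply: eq_bigr => s _; rewrite covering_polyE intrM.
rewrite /covering_poly -[- << _ *g _ >>]monalgUN lpoly_evalD lpoly_evalU mulNr.
rewrite /shape_poly lpoly_eval_sum; congr (_ - _).
by apply: eq_bigr => t _; rewrite lpoly_evalU mul1r.
Qed.

(** Reading [c] at the opposite point turns the exponents -t into a count over -x + D; subtracting
    (b - a) c(-x) levels the values [b] and [a] to [a]. *)
Lemma covering_sum (c : configuration) (x : Z2) : covering D b a c ->
  \sum_(s <- msupp g) covering_coef s * (c (- (x + s)))%:Z = a%:Z.
Proof.
move=> cov; rewrite (covering_coef_sum (fun s => (c (- (x + s)))%:Z)).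
have -> : \sum_(t <- D) (c (- (x - t)))%:Z
        = #|` [fset w in [fset - x + t | t in D] | c w]|%:Z.
  rewrite card_fset_sum1 big_fset eq_big_imfset /= => [|t t' _ _ /addrI //].
  rewrite big_map (big_morph Posz PoszD (erefl 0%:Z)) [RHS]big_mkcond.
  by apply: eq_bigr => t _; rewrite opprB addrC; case: (c _).
rewrite cov addr0; case: (c _); lia.
Qed.

Lemma covering_periodic (w : Z2) (c : configuration) :
  g != 0 ->
  (forall (v y : Z2) (zeta : C), cross v y = 1 -> cross v w != 0 ->
     zeta != 0 ->
     exists beta, fiber_at (msupp g) (fun s => g@_s) v y zeta beta != 0) ->
  covering D b a c -> exists2 N, (0 < N)%N & periodic_by c (w *+ N).
Proof.
move=> g0 fib0 cov; pose h (x : Z2) := (c (- x))%:Z.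
(* The difference of [h] along [w] is bounded by 1, and [g] annihilates it because [g] sends [h] to
   a constant. *)
have [||||||N N0 hN] := @annihilated_periodic C (msupp g) covering_coef w _
    (fun x => h (x + w) - h x) 1.
- move=> v y zeta vy vw zeta0; have [beta] := fib0 v y zeta vy vw zeta0.
  exists beta; rewrite /fiber_at; under eq_bigr => s _ do rewrite -covering_polyE.
  by [].
- exact: fset_uniq.
- have [u gu] := lpoly_neq0 g0; rewrite mcoeff_neq0 in gu.
  apply: contraTneq gu => s0.
  by rewrite -[u \in _]/(u \in enum_fset (msupp g)) s0.
- move=> s; rewrite -mcoeff_neq0 covering_polyE; apply: contraNneq => ->.
  by [].
- by move=> x; rewrite /h; case: (c _); case: (c _).
- move=> x; under eq_bigr => s _ do rewrite mulrBr addrAC.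
  by rewrite sumrB !(covering_sum _ cov) subrr.
have fh : finitely_valued h.
  by exists [:: 0; 1] => x; rewrite /h; case: (c _).
have [//|K K0 hK] := @finitely_valued_period_period _ h w 1 N _ N0 fh hN.
exists K => // u; have := hK (- u - w *+ K); rewrite subrK /h opprK => E.
by move: E; rewrite opprD !opprK; case: (c _); case: (c _).
Qed.

Lemma phi_coef (n k : nat) : (phi R n)`_k = (k < n)%:R.
Proof.
rewrite /phi coef_sum; under eq_bigr => i _ do rewrite coefXn.
have [kn | nk] := ltnP k n.
  rewrite (bigD1 (Ordinal kn)) //= eqxx big1 ?addr0 // => i ik.
  by rewrite eq_sym -val_eqE in ik *; rewrite (negPf ik).
by rewrite big1 // => i _; case: eqP => // E; have := ltn_ord i; rewrite -E ltnNge nk.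
Qed.

Lemma sum_indicator (A : {fset Z2}) (d : Z2) (V : lmodType R) (F : Z2 -> V) :
  d \in A -> \sum_(w <- A) (w == d)%:R *: F w = F d.
Proof.
move=> dA; rewrite (bigD1_seq d) ?fset_uniq //= eq_refl scale1r big1 ?addr0 //.
by move=> w wd; rewrite (negPf wd) scale0r.
Qed.

Lemma convex_segment (d v : Z2) (k n : nat) :
  convex R D -> d \in D -> d + v *+ n \in D -> (k <= n)%N -> d + v *+ k \in D.
Proof.
move=> convD dD dnD kn; have [n0 | n_gt0] := posnP n.
  by move: kn dD; rewrite n0 leqn0 => /eqP -> //; rewrite addr0.
suff : [set` D] (d + v *+ k) by [].
rewrite convD /= /conv_hull /=; pose t : R := k%:R / n%:R.
have n0 : n%:R != 0 :> R by rewrite pnatr_eq0 -lt0n.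
have t0 : 0 <= t by rewrite divr_ge0 ?ler0n.
have t1 : 0 <= 1 - t by rewrite subr_ge0 ler_pdivrMr ?ltr0n // mul1r ler_nat.
exists (fun w => (w == d)%:R * (1 - t) + (w == d + v *+ n)%:R * t); split.
- by move=> w; rewrite addr_ge0 // mulr_ge0 ?ler0n.
- rewrite big_split /= (sum_indicator (V := R^o) (fun=> 1 - t) dD).
  by rewrite (sum_indicator (V := R^o) (fun=> t) dnD) subrK.
under eq_bigr => w _ do rewrite scalerDl -(scalerA _ (1 - t)) -(scalerA _ t).
rewrite big_split /= (sum_indicator (fun w => (1 - t) *: toR2 R w) dD).
rewrite (sum_indicator (fun w => t *: toR2 R w) dnD).
rewrite /toR2 !pmulrn !Z2_mulrzE /=; apply: injective_projections => /=.
  rewrite !intrD !intrM -!pmulrn /t /GRing.scale /=; field.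
  by [].
rewrite !intrD !intrM -!pmulrn /t /GRing.scale /=; field.
by [].
Qed.

(** Where the correction b - a at the origin is absent, the coefficients of a fiber are indicators
    of membership in [D], and convexity fills the gap between the extreme ones. *)
Lemma normal_form_phi (v y u : Z2) (q : {poly C}) :
  convex R D -> cross v y = 1 -> b%:Z - a%:Z = 0 \/ ~ on_line v u ->
  is_normal_form v (fiber g v u) q -> (0 < size q)%N /\ q = phi R (size q).
Proof.
move=> convD vy off [q0 [u0 fE]].
have qE k : q`_k = (fiber g v u)@_(u0 + v *+ k) by rewrite (normal_form_coef k vy fE).
have fibE k : (fiber g v u)@_(u0 + v *+ k) = (- (u0 + v *+ k) \in D)%:R.
  have := q0; rewrite qE addr0 !fiber_coef.
  case: asboolP => [/(on_lineE _ vy) u0u _|]; last by rewrite eqxx.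
  have uk : cross v (u0 + v *+ k - u) = 0.
    by rewrite -u0u pmulrn !Z2_mulrzE !crossE /=; ring.
  case: asboolP => [_|[]]; last exact/(on_lineE _ vy).
  rewrite covering_polyE /covering_coef.
  suff -> : (b%:Z - a%:Z) * (u0 + v *+ k == 0)%:Z = 0 by rewrite subr0 pmulrn.
  case: off => [-> | off]; first by rewrite mul0r.
  case: eqP => [E|]; last by rewrite mulr0.
  case: off; apply/(on_lineE _ vy); move: uk; rewrite E sub0r !crossE /=; lia.
have sq : (0 < size q)%N by rewrite lt0n size_poly_eq0; apply: contra_neq q0 => ->; rewrite coef0.
split=> //; apply/polyP => k; rewrite phi_coef.
case: ltnP => [kq|/(nth_default 0) //].
have inD j : q`_j != 0 -> - (u0 + v *+ j) \in D.
  by rewrite qE fibE; case: (_ \in D) => //; rewrite eqxx.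
rewrite qE fibE; suff -> : - (u0 + v *+ k) \in D by [].
(* Exponents are negatives of points of [D], so the segment runs in direction -v. *)
rewrite opprD -mulNrn; apply: (@convex_segment _ _ _ (size q).-1) => //.
- by have := inD _ q0; rewrite addr0.
- rewrite mulNrn -opprD; apply: inD; rewrite -lead_coefE lead_coef_eq0.
  by rewrite -size_poly_gt0.
- by rewrite -ltnS prednK.
Qed.

End Coverings.

(** * Common roots of the fibers, and the conclusion *)

Lemma phi_root_unity (R : realType) (n : nat) (zeta : R[i]) :
  (phi R n).[zeta] = 0 -> zeta ^+ n = 1.
Proof.
rewrite /phi horner_sum => phi0; apply/eqP; rewrite -subr_eq0 subrX1.
under eq_bigr => i _ do rewrite -hornerXn.
by rewrite phi0 mulr0.
Qed.

(** Bezout in the exponents; an empty list gives exponent 0. *)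
Lemma expr_gcdn_eq1 (F : fieldType) (zeta : F) (ns : seq nat) :
  (forall n, n \in ns -> zeta ^+ n = 1) ->
  zeta ^+ (\big[gcdn/0%N]_(n <- ns) n) = 1.
Proof.
elim: ns => [|n ns IH] ns1; first by rewrite big_nil expr0.
rewrite big_cons; set m := \big[_/_]_(_ <- _) _.
have m1 : zeta ^+ m = 1 by apply: IH => k kns; apply: ns1; rewrite inE kns orbT.
have n1 : zeta ^+ n = 1 by apply: ns1; rewrite mem_head.
have [n0 | n_gt0] := posnP n; first by rewrite n0 gcd0n.
have [k m' kE _] := egcdnP m n_gt0.
have : zeta ^+ (k * n) = 1 by rewrite mulnC exprM n1 expr1n.
by rewrite kE exprD mulnC exprM m1 expr1n mul1r.
Qed.

Section Theorem13.

Variables (R : realType) (D : {fset Z2}) (b a : nat).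

Hypothesis convD : convex R D.

Local Notation C := R[i].
Local Notation g := (covering_poly R D b a).

Hypothesis g_neq0 : g != 0.

Definition fibers_nonvanishing (v y : Z2) (zeta : C) : Prop :=
  exists beta, fiber_at (msupp g) (fun s => g@_s) v y zeta beta != 0.

(** The extreme line in direction [v] meets the support in a single point [t], so its fiber is a
    monomial. *)
Lemma no_outer_edge_nonvanishing (v y : Z2) (zeta : C) :
  cross v y = 1 -> zeta != 0 -> ~ outer_edge (msupp g) v ->
  fibers_nonvanishing v y zeta.
Proof.
move=> vy zeta0 noE; have [w0 gw0] := lpoly_neq0 g_neq0.
pose ht (w : Z2) := dot w (perp v).
have [t [tg tmin]] : exists t, t \in msupp g /\
    forall w, w \in msupp g -> ht t <= ht w.
  pose M := (\sum_(w <- msupp g) `|ht w|)%N.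
  have htM w : w \in msupp g -> (`|ht w| <= M)%N.
    by move=> wg; rewrite /M (big_rem _ wg) /= leq_addr.
  pose Q n := has (fun w => ht w + M%:Z == n%:Z) (msupp g).
  have exQ : exists n, Q n.
    exists (absz (ht w0 + M%:Z)); apply/hasP; exists w0.
      by rewrite -mcoeff_neq0.
    by rewrite mcoeff_neq0 in gw0; have := htM _ gw0; lia.
  case: (ex_minnP exQ) => n /hasP[t tg /eqP tn] nmin; exists t; split=> // w wg.
  have : (n <= absz (ht w + M%:Z)%R)%N.
    by apply: nmin; apply/hasP; exists w => //; have := htM _ wg; lia.
  by have := htM _ wg; lia.
have htB u : dot (u - t) (perp v) = ht u - ht t by rewrite /ht /dot /perp /=; ring.
have uniq_t w : w \in msupp g -> cross v w = cross v t -> w = t.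
  move=> wg wt; apply: contrapT => /eqP wt_neq; apply: noE; exists t; split.
    by move=> u ug; rewrite htB subr_ge0 tmin.
  apply: (@leq_trans #|` [fset w; t]|); first by rewrite cardfs2 wt_neq.
  apply: fsubset_leq_card; apply/fsubsetP => u; rewrite !inE => /orP[/eqP->|/eqP->].
    apply/andP; split=> //; rewrite htB; move: wt.
    by rewrite /ht !crossE /dot /perp /=; lia.
  by rewrite tg htB subrr /=.
exists (cross v t); rewrite /fiber_at big_mkcond (bigD1_seq t) ?fset_uniq //=.
rewrite eqxx big1_seq ?addr0 => [|w /andP[wt wg]].
  by rewrite mulf_neq0 ?mcoeff_neq0 // expfz_neq0.
by case: eqP => // /(uniq_t w wg) E; rewrite E eqxx in wt.
Qed.

Lemma normal_form_nonvanishing (v y u : Z2) (zeta : C) :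
  cross v y = 1 -> zeta != 0 -> fiber g v u != 0 ->
  (normal_form v (fiber g v u)).[zeta] != 0 -> fibers_nonvanishing v y zeta.
Proof.
move=> vy zeta0 fu qz; exists (cross v u).
have [k ->] := normal_form_eval vy zeta0 (normal_formP vy fu).
by rewrite mulf_neq0 // expfz_neq0.
Qed.

(** [P] selects all fibers, or those off the line through the origin. Its invariance along [v] lets
    finitely many support points represent the selected fibers. *)
Lemma phi_family_exists (P : Z2 -> Prop) (v : Z2) :
  primitive v -> (forall u, P u -> b%:Z - a%:Z = 0 \/ ~ on_line v u) ->
  (forall u k, P u -> P (u + v *~ k)) ->
  exists ns, phi_family
    [set normal_form v (fiber g v u) | u in [set u | P u /\ fiber g v u != 0]] ns.
Proof.
move=> /primitive_basis[y vy] Poff Pline.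
have nfE u : P u -> fiber g v u != 0 ->
    (0 < size (normal_form v (fiber g v u)))%N /\
    normal_form v (fiber g v u) = phi R (size (normal_form v (fiber g v u))).
  move=> Pu fu; apply: (normal_form_phi convD vy (Poff u Pu)).
  exact: (normal_formP vy fu).
pose good w := `[< P w >] && (fiber g v w != 0).
exists [seq size (normal_form v (fiber g v w)) | w <- msupp g & good w]; split.
  apply/allP => n /mapP[w]; rewrite mem_filter => /andP[/andP[/asboolP Pw fw] _] ->.
  by case: (nfE w Pw fw).
apply/seteqP; split=> [q /= [u [Pu fu] <-]|q /= [n]].
  have [w fw] := lpoly_neq0 fu.
  have := fw; rewrite fiber_coef; case: asboolP => [|_]; last by rewrite eqxx.
  move=> [k wE]; rewrite mcoeff_neq0 => wg.
  have {}wE : w = u + v *~ k by rewrite -wE addrC subrK.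
  have fE : fiber g v w = fiber g v u.
    apply/malgP => x; rewrite !fiber_coef; congr (if _ then _ else _).
    apply/asboolP/asboolP => /(on_lineE _ vy) H; apply/(on_lineE _ vy).
      by move: H; rewrite wE Z2_mulrzE !crossE /= => H; rewrite -[RHS]H; ring.
    by move: H; rewrite wE Z2_mulrzE !crossE /= => H; rewrite -[RHS]H; ring.
  exists (size (normal_form v (fiber g v w))).
    apply/mapP; exists w => //; rewrite mem_filter wg andbT /good fE fu andbT.
    by apply/asboolP; rewrite wE; apply: Pline.
  by rewrite fE; case: (nfE u Pu fu).
move=> /mapP[w]; rewrite mem_filter => /andP[/andP[/asboolP Pw fw] _] -> <-.
by exists w => //; case: (nfE w Pw fw).
Qed.

Lemma phi_gcd_root (F : set {poly C}) (zeta : C) :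
  (exists ns, phi_family F ns) -> (forall q, F q -> q.[zeta] = 0) ->
  zeta ^+ phi_gcd F = 1.
Proof.
move=> exF Fz; have [_ FE] := xgetPex [::] exF.
apply: expr_gcdn_eq1 => n ns_n; apply: phi_root_unity; apply: Fz.
by rewrite FE; exists n.
Qed.

(** A non-zero gcd comes from a non-empty family, and phi_n takes the value n > 0 at 1. *)
Lemma phi_gcd_root1 (F : set {poly C}) (zeta : C) :
  (exists ns, phi_family F ns) -> phi_gcd F <> 0%N ->
  (forall q, F q -> q.[zeta] = 0) -> zeta != 1.
Proof.
move=> exF d0 Fz; have [/allP ns1 FE] := xgetPex [::] exF.
apply/eqP => z1; apply: d0; rewrite /phi_gcd; move: ns1 FE.
case: (xget _ _) => [|n ns] ns1 FE; first by rewrite big_nil.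
have n1 := ns1 n (mem_head _ _).
have phi_n : (phi R n).[zeta] = n%:R.
  rewrite /phi horner_sum (eq_bigr (fun=> 1)) => [|i _].
    by rewrite sumr_const card_ord.
  by rewrite hornerXn z1 expr1n.
have /eqP : (phi R n).[zeta] = 0.
  by apply: Fz; rewrite FE; exists n => //=; exact: mem_head.
by rewrite phi_n pnatr_eq0 => /eqP n0; rewrite n0 in n1.
Qed.

Lemma fibers_family (v : Z2) : b%:Z - a%:Z = 0 -> primitive v ->
  exists ns, phi_family (fibers g v) ns.
Proof.
move=> ba pv.
have [u _||ns nsP] := @phi_family_exists (fun=> True) v pv; [by left|by []|].
rewrite /fibers; suff <- : [set u | True /\ fiber g v u != 0] = [set u | fiber g v u != 0].
  by exists ns.
by apply/seteqP; split=> u //= [].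
Qed.

Lemma fibers'_family (v : Z2) : primitive v ->
  exists ns, phi_family (fibers' g v) ns.
Proof.
move=> pv; have /primitive_basis[y vy] := pv.
apply: (@phi_family_exists (fun u => ~ on_line v u) v pv); first by right.
move=> u k nu /(on_lineE _ vy) H; apply: nu; apply/(on_lineE _ vy).
by move: H; rewrite Z2_mulrzE !crossE /= => H; rewrite -[RHS]H; ring.
Qed.

Lemma fibers_gcd1_nonvanishing (v y : Z2) (zeta : C) : b%:Z - a%:Z = 0 ->
  cross v y = 1 -> zeta != 0 -> phi_gcd (fibers g v) = 1%N ->
  fibers_nonvanishing v y zeta.
Proof.
move=> ba vy zeta0 d1; apply: contrapT => van.
have pv : primitive v by apply/primitive_basis; exists y.
have ex := fibers_family ba pv.
have Fz q : fibers g v q -> q.[zeta] = 0.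
  move=> [u /= fu <-]; apply/eqP/negPn/negP => qz; apply: van.
  exact: (normal_form_nonvanishing vy zeta0 fu qz).
have /eqP : zeta != 1 by apply: (phi_gcd_root1 ex _ Fz); rewrite d1.
by apply; have := phi_gcd_root ex Fz; rewrite d1 expr1.
Qed.

(** If all fibers vanished at zeta, then zeta would be a root of phi_d, and by coprimality the fiber
    through the origin could not vanish there. *)
Lemma coprime_nonvanishing (v y : Z2) (zeta : C) :
  cross v y = 1 -> zeta != 0 -> no_common_factor g v ->
  fibers_nonvanishing v y zeta.
Proof.
move=> vy zeta0 cop; apply: contrapT => van.
have pv : primitive v by apply/primitive_basis; exists y.
have ex := fibers'_family pv.
have Fz q : fibers' g v q -> q.[zeta] = 0.
  move=> [u /= [_ fu] <-]; apply/eqP/negPn/negP => qz; apply: van.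
  exact: (normal_form_nonvanishing vy zeta0 fu qz).
have phi0 : root (phi R (phi_gcd (fibers' g v))) zeta.
  (* An empty family has d = 0, and phi_0 = 0 has every zeta as a root. *)
  have [d0|/eqP d0] := eqVneq (phi_gcd (fibers' g v)) 0%N.
    by rewrite d0 /phi big_ord0 root0.
  have z1 := phi_gcd_root1 ex d0 Fz.
  have := phi_gcd_root ex Fz => /eqP; rewrite -subr_eq0 subrX1 mulf_eq0.
  rewrite subr_eq0 (negPf z1) /= => /eqP sum0; apply/rootP.
  by rewrite /phi horner_sum -[RHS]sum0; apply: eq_bigr => i _; rewrite hornerXn.
have := coprimep_root cop phi0; rewrite /fib => fz; apply: van.
(* A zero fiber has the default normal form 0, which contradicts [fz]. *)
have [f0|f0] := eqVneq (fiber g v 0) 0; last first.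
  exact: (normal_form_nonvanishing vy zeta0 f0 fz).
case/eqP: fz; rewrite f0 /normal_form xgetPN ?horner0 // => q [q0 [u fE]].
have := normal_form_coef 0 vy fE; rewrite mcoeff0 => q00.
by rewrite -q00 eqxx in q0.
Qed.

(** There is a period along any [w] parallel to all bad edge directions: along both axes if none is
    bad, along a bad direction if all bad ones are parallel. *)
Lemma good_directions_periodic (good : Z2 -> Prop) (c : configuration) :
  (forall (v y : Z2) (zeta : C), edge_directions g v -> good v ->
     cross v y = 1 -> zeta != 0 -> fibers_nonvanishing v y zeta) ->
  covering D b a c ->
  ((forall v, edge_directions g v -> good v) -> two_periodic c) /\
  ((forall v w, edge_directions g v -> edge_directions g w ->
      ~ good v -> ~ good w -> parallel v w) -> periodic c).
Proof.
move=> goodP cov.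
have per w : (forall v, edge_directions g v -> ~ good v -> cross v w = 0) ->
    exists2 N, (0 < N)%N & periodic_by c (w *+ N).
  move=> bad; apply: (covering_periodic g_neq0 _ cov) => v y zeta vy vw zeta0.
  have pv : primitive v by apply/primitive_basis; exists y.
  have [oe|noe] := pselect (outer_edge (msupp g) v); last first.
    exact: no_outer_edge_nonvanishing.
  apply: goodP => //; apply: contrapT => /(bad v (conj pv oe)) vw0.
  by rewrite vw0 eqxx in vw.
split=> [allgood|bad_parallel].
  have [|N N0 cN] := per (1, 0); first by move=> v /allgood.
  have [|M M0 cM] := per (0, 1); first by move=> v /allgood.
  exists ((1, 0) *+ N), ((0, 1) *+ M); split=> //.
  rewrite /parallel -/(cross _ _) !pmulrn !Z2_mulrzE crossE /=; nia.
have [[v0 [Ev0 bad0]]|nobad] := pselect (exists v, edge_directions g v /\ ~ good v).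
  have [|N N0 cN] := per v0; first by move=> v Ev bv; apply: bad_parallel.
  exists (v0 *+ N) => //; have /primitive_basis[y v0y] := proj1 Ev0.
  apply: contra_eq_neq v0y => E; rewrite -[cross v0 y]/(cross v0 y).
  have : cross (v0 *+ N) y = 0 by rewrite E crossE /=; ring.
  rewrite pmulrn Z2_mulrzE !crossE /=; nia.
have [|N N0 cN] := per (1, 0).
  by move=> v Ev bv; case: nobad; exists v.
by exists ((1, 0) *+ N) => //; rewrite pmulrn Z2_mulrzE; apply/eqP => -[]; lia.
Qed.

End Theorem13.

(** The assumption [g_neq0] excludes cases such as D = {0}, b = 1, a = 0, where [E] is empty and
    every configuration is a covering. *)
Theorem theorem13 (R : realType) (D : {fset Z2}) (a b : nat)
    (convD : convex R D) (g_neq0 : covering_poly R D b a != 0) :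
  let g := covering_poly R D b a in
  let E := edge_directions g in
  (b%:Z - a%:Z = 0 ->
     let d v := phi_gcd (fibers g v) in
     [/\ forall v, E v -> exists ns, phi_family (fibers g v) ns,
         (forall v, E v -> d v = 1%N) ->
           forall c, covering D b a c -> two_periodic c &
         (forall v w, E v -> E w -> d v <> 1%N -> d w <> 1%N -> parallel v w) ->
           forall c, covering D b a c -> periodic c]) /\
  (b%:Z - a%:Z <> 0 ->
     [/\ forall v, E v -> exists ns, phi_family (fibers' g v) ns,
         (forall v, E v -> no_common_factor g v) ->
           forall c, covering D b a c -> two_periodic c,
         (forall v w, E v -> E w ->
            ~ no_common_factor g v -> ~ no_common_factor g w ->
            parallel v w) ->
           forall c, covering D b a c -> periodic c &
         forall v, E v -> phi_gcd (fibers' g v) = 1%N -> no_common_factor g v]).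
Proof.
move=> g E; split=> [ba d|_].
  have good c := @good_directions_periodic R D b a g_neq0 (fun v => d v = 1%N) c
    (fun v y zeta _ dv vy z0 => fibers_gcd1_nonvanishing convD ba vy z0 dv).
  split=> [v [pv _]|H c /good[two _]|H c /good[_ one]].
  - exact: fibers_family.
  - exact: two.
  - exact: one.
have good c := @good_directions_periodic R D b a g_neq0 (no_common_factor g) c
  (fun v y zeta _ dv vy z0 => coprime_nonvanishing convD vy z0 dv).
split=> [v [pv _]|H c /good[two _]|H c /good[_ one]|v _ d1].
- exact: fibers'_family.
- exact: two.
- exact: one.
by rewrite /no_common_factor d1 /phi big_ord_recl big_ord0 addr0 expr0 coprime1p.
Qed.
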